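(* Let $T\subset\mathbb{R}^d$ be compact and let $\{W(t),t\in T\}$ be a Gaussian process with continuous sample paths, having mean function $\mu(t)$ and continuous covariance kernel $\sigma(s,t)$. Assume that $\mu$ and a (nonrandom) function $w:T\to\mathbb{R}$ belong to the RKHS of the kernel $\sigma$, in the sense defined in the context. Then $$\mathrm{P}\Big(\sup_{t\in T}|W(t)-w(t)|<\varepsilon\Big)>0\qquad\text{for all }\varepsilon>0.$$
   Context: The paper uses ''RKHS of the kernel $\sigma$'' for the closure, in the supremum metric on $T$, of the set of finite linear combinations $\big\{t\mapsto\sum_{i=1}^k a_i\sigma(t,t_i):\ k\ge1,\ a_1,\dots,a_k\in\mathbb{R},\ t_1,\dots,t_k\in T\big\}$. *)

(* Defs.v *)
From HB Require Import structures.
From mathcomp Require Import all_boot all_order all_algebra.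
From mathcomp Require Import all_classical all_reals all_analysis.

Set Implicit Arguments.
Unset Strict Implicit.
Unset Printing Implicit Defensive.

Import Order.TTheory GRing.Theory Num.Theory.
Import numFieldNormedType.Exports.

Local Open Scope classical_set_scope.
Local Open Scope ring_scope.

(* [normal_prob m 0] is the uniform law on [0, 1] in the library, so the
   degenerate normal law N(m, 0) is given separately as a Dirac mass. *)
Definition gaussian_law (R : realType) (m s : R) : set R -> \bar R :=
  if s == 0 then \d_m else normal_prob m s.

Definition is_gaussian (dO : measure_display) (Omega : measurableType dO)
    (R : realType) (P : probability Omega R) (X : Omega -> R) : Prop :=
  exists m s : R, 0 <= s /\
    forall A : set R, measurable A -> pushforward P X A = gaussian_law m s A.

(* The finite-dimensional distributions are multivariate normal, possibly
   singular: every finite linear combination is univariate normal. *)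
Definition gaussian_process (dO : measure_display) (Omega : measurableType dO)
    (R : realType) (P : probability Omega R) (I : Type)
    (W : I -> {RV P >-> R}) : Prop :=
  forall (k : nat) (a : 'I_k -> R) (t : 'I_k -> I),
    is_gaussian P (fun omega => \sum_(i < k) a i * W (t i) omega).

Definition has_mean (dO : measure_display) (Omega : measurableType dO)
    (R : realType) (P : probability Omega R) (I : Type)
    (W : I -> {RV P >-> R}) (mu : I -> R) : Prop :=
  forall t : I, 'E_P[W t]%E = (mu t)%:E.

Definition has_covariance (dO : measure_display) (Omega : measurableType dO)
    (R : realType) (P : probability Omega R) (I : Type)
    (W : I -> {RV P >-> R}) (sigma : I -> I -> R) : Prop :=
  forall s t : I, covariance P (W s) (W t) = (sigma s t)%:E.

Definition kernel_span (R : realType) (I : choiceType) (sigma : I -> I -> R)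
    : set (I -> R) :=
  [set f | exists (k : nat) (a : 'I_k -> R) (u : 'I_k -> I),
    (0 < k)%N /\ f = fun t => \sum_(i < k) a i * sigma t (u i)].

(* This is the closure of the span for uniform convergence, which is larger in
   general than the Hilbert space usually called the RKHS of sigma. *)
Definition rkhs (R : realType) (I : choiceType) (sigma : I -> I -> R)
    : set (I -> R) :=
  closure (kernel_span sigma : set {uniform I -> R}).

Lemma rkhsP (R : realType) (I : choiceType) (sigma : I -> I -> R) (f : I -> R) :
  rkhs sigma f <->
  forall e : R, 0 < e ->
    exists2 g, kernel_span sigma g &
      (ereal_sup (range (fun t => `|f t - g t|%:E)) < e%:E)%E.
Proof.
split.
- move=> cf e e0.
  have e20 : 0 < e / 2 by rewrite divr_gt0.
  have : nbhs (f : {uniform I -> R})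
      [set g : {uniform I -> R} | forall t, `|f t - g t| < e / 2].
    apply/uniform_nbhs; exists [set xy | ball xy.1 (e / 2) xy.2]; split.
      by rewrite -entourage_ballE; exists (e / 2).
    by move=> g /= fg t; exact: fg.
  move=> /cf[g [sg /= fg]]; exists g => //.
  apply: (@le_lt_trans _ _ (e / 2)%:E).
    by apply: ge_ereal_sup => _ [t _ <-]; rewrite lee_fin ltW.
  by rewrite lte_fin ltr_pdivrMr// ltr_pMr// ltr1n.
- move=> fP B /uniform_nbhs[E [entE EB]].
  move: entE; rewrite -entourage_ballE => -[e /= e0 eE].
  have [g sg fg] := fP _ e0.
  exists g; split=> //; apply: EB => t _; apply: eE => /=.
  rewrite /ball/= -lte_fin; apply: le_lt_trans fg.
  by apply: ereal_sup_ubound; exists t.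
Qed.

(* Main.v *)
(** Pick [h = sum_j a_j sigma(., u_j)] uniformly close to [w - mu], put
    [Y = sum_j a_j W(u_j)], [v = Var Y], and let [A t = W t - (h t / v) Y] be the
    residual of the regression on [Y].  Take two independent copies [A1], [A2] of
    the residual and an independent standard normal [x].  The process
    [(A1 - A2) / sqrt 2 + (h / sqrt v) x + mu] has the same moment generating
    functions as [W], hence the same law.  It is close to [h + mu], hence to [w],
    when [x] is near [sqrt v] and [A1], [A2] are uniformly close to each other.
    The latter has positive probability: each continuous path on the compact [T]
    is described up to [eta] by a finite list of basic open sets and rational
    values, there are countably many lists, so one of them occurs with positive
    probability, and two paths with the same list are [2 eta]-close.

    Equality of laws is obtained without characteristic functions: the
    functionals of the path with equal expectations contain the exponentials of
    linear combinations and are stable under dominated limits, and the indicators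
    of countable boxes are reached from exponentials by such limits. *)

Require Import Defs.
From HB Require Import structures.
From mathcomp Require Import all_boot all_order all_algebra.
From mathcomp Require Import all_classical all_reals all_analysis.
From mathcomp Require Import measurable_realfun.
From mathcomp Require Import ring lra.

Set Implicit Arguments.
Unset Strict Implicit.
Unset Printing Implicit Defensive.

Import Order.TTheory GRing.Theory Num.Theory.
Import numFieldNormedType.Exports.

Local Open Scope classical_set_scope.
Local Open Scope ring_scope.

(** * Closure under dominated limits *)

Section dominated_closure.
Context {R : realType} {S : Type}.
Implicit Types (E : set (S -> R)) (f g : S -> R).

(* The dominating function of a limit must itself lie in the closure, so that its
   integrability comes by induction. *)
Inductive dclosure E : (S -> R) -> Prop :=
| dclosure_base f : E f -> dclosure E f
| dclosure_lin (a : R) f g : dclosure E f -> dclosure E g ->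
    dclosure E (fun s => a * f s + g s)
| dclosure_lim (f_ : nat -> S -> R) f g :
    (forall n, dclosure E (f_ n)) -> dclosure E g ->
    (forall n s, `|f_ n s| <= g s) ->
    (forall s, f_ n s @[n --> \oo] --> f s) -> dclosure E f.

(** A member of [E] is nonnegative and dominates itself, a combination is dominated by
    [|a| f' + g'], and a limit by the bound that it comes with. *)
Lemma dclosure_dominated E f : (forall g, E g -> forall s, 0 <= g s) ->
  dclosure E f -> exists2 g, dclosure E g & forall s, `|f s| <= g s.
Proof.
move=> E0; elim=> {f} [f Ef|a f g _ [f' Ef' ff'] _ [g' Eg' gg']|f_ f g Ef_ _ Eg _ f_g f_f].
- by exists f => [|s]; [exact: dclosure_base|rewrite ger0_norm ?E0].
- exists (fun s => `|a| * f' s + g' s) => [|s]; first exact: dclosure_lin.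
  by rewrite (le_trans (ler_normD _ _))// normrM lerD ?ler_wpM2l.
- exists g => // s.
  by apply: (cvgr_to_le (cvg_norm (f_f s))); apply: nearW => n; exact: f_g.
Qed.

(** Two inductions: first on the left factor with the right one in [E], then on the right factor for
    arbitrary left ones. In the limit case of the second, the bound is a dominating function of [f]
    times the bound of the sequence, which is in the closure by induction. *)
Lemma dclosureM E f g : (forall h, E h -> forall s, 0 <= h s) ->
  (forall h k, E h -> E k -> E (fun s => h s * k s)) ->
  dclosure E f -> dclosure E g -> dclosure E (fun s => f s * g s).
Proof.
move=> E0 EM Ef Eg.
have EMl h k : dclosure E h -> E k -> dclosure E (fun s => h s * k s).
  move=> + Ek; elim=> {h} [h Eh|a h l _ hk _ lk|h_ h l _ hk_ El lk h_l h_h].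
  - exact/dclosure_base/EM.
  - rewrite (_ : (fun s => _) = (fun s => a * (h s * k s) + l s * k s)).
      exact: dclosure_lin.
    by apply/funext => s; rewrite mulrDl mulrA.
  - apply: (dclosure_lim hk_ lk) => [n s|s]; last by apply: cvgM => //; exact: cvg_cst.
    by rewrite normrM (ger0_norm (E0 _ Ek _)) ler_wpM2r// E0.
elim: Eg f Ef => {g} [g Eg f /EMl|a g l _ fg _ fl f Ef|g_ g l _ fg_ El fl g_l g_g f Ef].
- exact.
- rewrite (_ : (fun s => _) = (fun s => a * (f s * g s) + f s * l s)).
    by apply: dclosure_lin; [exact: fg|exact: fl].
  by apply/funext => s; rewrite mulrDr mulrCA.
- have [f' Ef' ff'] := dclosure_dominated E0 Ef.
  apply: (dclosure_lim (fun n => fg_ n f Ef) (fl _ Ef')) => [n s|s].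
    by rewrite normrM ler_pM.
  by apply: cvgM => //; exact: cvg_cst.
Qed.

Section transfer.
Local Open Scope ereal_scope.
Context d1 d2 (T1 : measurableType d1) (T2 : measurableType d2).
Variables (m1 : {measure set T1 -> \bar R}) (m2 : {measure set T2 -> \bar R}).
Variables (phi1 : T1 -> S) (phi2 : T2 -> S).

(** Linearity and dominated convergence carry the equality through the closure. Integrability is
    proved along with it, because the limit case needs it for the bound. *)
Lemma dclosure_integral E :
  (forall f, E f -> [/\ m1.-integrable [set: T1] (EFin \o f \o phi1),
    m2.-integrable [set: T2] (EFin \o f \o phi2) &
    \int[m1]_x (f (phi1 x))%:E = \int[m2]_x (f (phi2 x))%:E]) ->
  forall f, dclosure E f ->
    [/\ m1.-integrable [set: T1] (EFin \o f \o phi1),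
    m2.-integrable [set: T2] (EFin \o f \o phi2) &
    \int[m1]_x (f (phi1 x))%:E = \int[m2]_x (f (phi2 x))%:E].
Proof.
have lin d (T : measurableType d) (m : {measure set T -> \bar R}) (a : R)
    (h k : T -> R) :
    m.-integrable [set: T] (EFin \o h) -> m.-integrable [set: T] (EFin \o k) ->
    m.-integrable [set: T] (fun x => (a * h x + k x)%:E) /\
    \int[m]_x (a * h x + k x)%:E =
      a%:E * (\int[m]_x (h x)%:E) + \int[m]_x (k x)%:E.
  move=> ih ik; have iah : m.-integrable [set: T] (fun x => a%:E * (h x)%:E).
    exact: integrableZl.
  split; first exact: (integrableD measurableT iah ik).
  under eq_integral do rewrite EFinD EFinM.
  by rewrite integralD// integralZl.
have lim d (T : measurableType d) (m : {measure set T -> \bar R})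
    (h_ : nat -> T -> R) (h k : T -> R) :
    (forall n, m.-integrable [set: T] (EFin \o h_ n)) ->
    m.-integrable [set: T] (EFin \o k) ->
    (forall n x, `|h_ n x| <= k x)%R ->
    (forall x, h_ n x @[n --> \oo] --> h x)%R ->
    m.-integrable [set: T] (EFin \o h) /\
    \int[m]_x (h_ n x)%:E @[n --> \oo] --> \int[m]_x (h x)%:E.
  move=> ih_ ik h_k h_h.
  have mh_ n : measurable_fun [set: T] (h_ n).
    exact/measurable_EFinP/(measurable_int m).
  have mh : measurable_fun [set: T] h.
    exact: (measurable_fun_cvg mh_).
  have [] := @dominated_convergence _ _ _ m _ measurableT
    (fun n => EFin \o h_ n) (EFin \o h) (EFin \o k) => //.
  - by move=> n; exact: measurable_int (ih_ n).
  - exact/measurable_EFinP.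
  - by apply/aeW => x _; apply/fine_cvgP; split; [exact: nearW|exact: h_h].
  - by apply/aeW => x n _; rewrite lee_fin.
move=> EP f; elim=> {f} [f /EP//|a f g _ [if1 if2 fE] _ [ig1 ig2 gE]|].
  have [? e1] := lin _ _ _ a _ _ if1 ig1.
  have [? e2] := lin _ _ _ a _ _ if2 ig2.
  by split => //; rewrite e1 e2 fE gE.
move=> f_ f g _ if_ _ [ig1 ig2 _] f_g f_f.
have [? e1] := lim _ _ m1 (fun n => f_ n \o phi1) (f \o phi1) (g \o phi1)
  (fun n => let: And3 a _ _ := if_ n in a) ig1 (fun n x => f_g n _) (fun x => f_f _).
have [? e2] := lim _ _ m2 (fun n => f_ n \o phi2) (f \o phi2) (g \o phi2)
  (fun n => let: And3 _ a _ := if_ n in a) ig2 (fun n x => f_g n _) (fun x => f_f _).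
split=> //; apply: (cvg_unique _ e1) => //.
rewrite (_ : (fun n => _) = fun n => \int[m2]_x ((f_ n \o phi2) x)%:E)//.
by apply/funext => n; have [] := if_ n.
Qed.

End transfer.
End dominated_closure.

(** * Bounds and limits for the exponential, the sine and a smoothstep polynomial *)

Section real_lemmas.
Context {R : realType}.
Implicit Types x y : R.

Lemma expR_sub1_le x : expR x - 1 <= x * expR x.
Proof.
have := expR_ge1Dx (- x); rewrite expRN => h.
have x0 := expR_gt0 x.
have := ler_wpM2r (ltW x0) h; rewrite mulVf ?gt_eqF// mulrBl mul1r; lra.
Qed.

Lemma expR_norm_le x : expR `|x| <= expR x + expR (- x).
Proof.
have := expR_ge0 x; have := expR_ge0 (- x).
by case: (ger0P x) => _; lra.
Qed.

Lemma norm_expR_sub1_le x : `|expR x - 1| <= `|x| * expR `|x|.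
Proof.
have [x0|x0] := leP 0 x.
  rewrite (ger0_norm x0) ger0_norm ?expR_sub1_le//.
  by rewrite subr_ge0 -expR0 ler_expR.
rewrite (ltr0_norm x0) ler0_norm; last first.
  by rewrite subr_le0 -expR0 ler_expR ltW.
rewrite opprB (@le_trans _ _ (- x))//.
  by have := expR_ge1Dx x; lra.
by rewrite ler_peMr ?oppr_ge0 ?ltW// -expR0 ltr_expR oppr_gt0.
Qed.

(** A difference quotient of the exponential at 0, squeezed between [x] and
    [x * expR (x / n.+1%:R)]. *)
Lemma cvg_expR_sub1 x :
  n.+1%:R * (expR (x / n.+1%:R) - 1) @[n --> \oo] --> x.
Proof.
have h : x / n.+1%:R @[n --> \oo] --> (0 : R).
  by rewrite -(mulr0 x); apply: cvgM; [exact: cvg_cst|exact: cvg_harmonic].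
apply: (@squeeze_cvgr _ _ _ _ (fun=> x) (fun n => x * expR (x / n.+1%:R))).
- apply: nearW => n; apply/andP; split.
    have := expR_ge1Dx (x / n.+1%:R) => hx.
    rewrite -(@ler_pM2l _ n.+1%:R^-1) ?invr_gt0// mulKf// mulrC.
    by rewrite lerBrDl.
  have := expR_sub1_le (x / n.+1%:R) => hx.
  by rewrite -(@ler_pM2l _ n.+1%:R^-1) ?invr_gt0// mulKf// mulrA (mulrC _ x).
- exact: cvg_cst.
- rewrite -[X in _ --> X]mulr1 -[X in x * X](@expR0 R).
  apply: cvgM; first exact: cvg_cst.
  by apply: (cvg_comp _ expR h); exact: continuous_expR.
Qed.

(** A bound free of [n], for dominated convergence: in [|y| * expR |y|] the factor [|y|] absorbs
    [n.+1]. *)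
Lemma norm_scaled_expR_sub1_le n x :
  `|n.+1%:R * (expR (x / n.+1%:R) - 1)| <= expR (2 * `|x|).
Proof.
set y := x / n.+1%:R.
have xy : `|x| = n.+1%:R * `|y| by rewrite normrM [`|_^-1|]ger0_norm// mulrC divfK.
have yx : `|y| <= `|x| by rewrite xy ler_peMl// ler1n.
rewrite normrM normr_nat.
rewrite (le_trans (ler_wpM2l _ (norm_expR_sub1_le y)))// mulrA -xy.
rewrite mulr_natl mulr2n expRD; apply: ler_pM; rewrite ?expR_ge0 ?ler_expR//.
by have := expR_ge1Dx `|x|; lra.
Qed.

Lemma norm_series_sin_coeff x n : `|series (sin_coeff x) n| <= expR `|x|.
Proof.
have le_n : `|series (sin_coeff x) n| <= series (exp_coeff `|x|) n.
  rewrite /series/= (le_trans (ler_norm_sum _ _ _))// ler_sum// => i _.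
  rewrite /sin_coeff /exp_coeff/= !normrM normfV !normrX normrN1 expr1n mulr1.
  rewrite !normr_nat -mulrA ler_piMl ?divr_ge0 ?exprn_ge0//.
  by rewrite -[leRHS]/(1%:R) ler_nat leq_b1.
apply: (le_trans le_n); apply: nondecreasing_cvgn_le.
  by apply/nondecreasing_series => k _ _; exact: exp_coeff_ge0.
exact: is_cvg_series_exp_coeff.
Qed.

(** The pointwise limit on [[0, 1]] of the iterates of the polynomial [smooth], whose fixed points
    are 0, 1/2 and 1. Through it polynomials produce a step. *)
Definition half_step x : R := if x < 2^-1 then 0 else if x == 2^-1 then 2^-1 else 1.

Let smooth x := 3 * x ^+ 2 - 2 * x ^+ 3.

Lemma smoothstep_itv n x : 0 <= x <= 1 -> 0 <= iter n smooth x <= 1.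
Proof.
move=> x01; elim: n => //= n /andP[h0 h1]; set z := iter n smooth x in h0 h1 *.
apply/andP; split.
  rewrite (_ : smooth z = z ^+ 2 * (3 - 2 * z)); last by rewrite /smooth; ring.
  by rewrite mulr_ge0 ?sqr_ge0//; lra.
rewrite -subr_ge0 (_ : 1 - smooth z = (1 - z) ^+ 2 * (1 + 2 * z)).
  by rewrite mulr_ge0 ?sqr_ge0//; lra.
by rewrite /smooth; ring.
Qed.

Lemma cvg_smoothstep x : 0 <= x <= 1 ->
  iter n smooth x @[n --> \oo] --> half_step x.
Proof.
have small y : 0 <= y -> y < 2^-1 -> iter n smooth y @[n --> \oo] --> (0 : R).
  (* One iteration multiplies [z] by [z * (3 - 2 * z)], which increases on [[0, 1/2]]. The iterates
     never exceed [y], so [r] bounds every factor and the decay is geometric. *)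
  move=> y0 y2; pose r := y * (3 - 2 * y).
  have r0 : 0 <= r by rewrite /r; nra.
  have r1 : r < 1 by rewrite /r; nra.
  have h n : 0 <= iter n smooth y <= y * r ^+ n /\ iter n smooth y <= y.
    elim: n => [|n [/andP[a b] c]] /=; first by rewrite mulr1 y0 !lexx.
    set z := iter n smooth y in a b c *.
    have smoothE : smooth z = z * (z * (3 - 2 * z)) by rewrite /smooth; ring.
    have z0 : 0 <= smooth z by rewrite smoothE !mulr_ge0//; lra.
    have zr : smooth z <= z * r by rewrite smoothE ler_wpM2l// /r; nra.
    split; last by rewrite (le_trans zr)// (le_trans _ c)// ler_piMr// ltW.
    rewrite z0/= (le_trans zr)// exprSr mulrA.
    by rewrite ler_wpM2r.
  apply: (@squeeze_cvgr _ _ _ _ (fun=> 0) (fun n => y * r ^+ n)).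
  - by apply: nearW => n; have [] := h n.
  - exact: cvg_cst.
  - rewrite -(mulr0 y); apply: cvgM; first exact: cvg_cst.
    by apply: cvg_expr; rewrite ger0_norm.
move=> /andP[x0 x1]; rewrite /half_step; case: ifPn => [|]; first exact: small.
rewrite -leNgt => x2; case: ifPn => [/eqP ->|x2'].
  rewrite (_ : (fun n => _) = fun=> 2^-1); first exact: cvg_cst.
  by apply/funext; elim=> //= n ->; rewrite /smooth; lra.
(* [smooth] commutes with the reflection of [x] to [1 - x], which brings the upper half back to the
   lower one. *)
have h n : iter n smooth x = 1 - iter n smooth (1 - x).
  elim: n => [|n IH] /=; first by rewrite subKr.
  by rewrite IH /smooth; ring.
rewrite (_ : (fun n => _) = fun n => 1 - iter n smooth (1 - x)); last exact/funext.
rewrite -[X in _ --> X]subr0; apply: cvgB; first exact: cvg_cst.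
apply: small; first by lra.
have : 2^-1 < x by rewrite lt_neqAle eq_sym x2' x2.
by lra.
Qed.

End real_lemmas.

(** * Events of the path space *)

(** The two families are concatenated. The new coefficients and points serve all [F] at once, so
    that [F] may be a path, a mean function or a section of the kernel. *)
Lemma lincomb_add (R : realType) (I : Type) k l (b : 'I_k -> R) (t : 'I_k -> I)
    (c : 'I_l -> R) (u : 'I_l -> I) (x : R) :
  exists (a : 'I_(k + l) -> R) (r : 'I_(k + l) -> I), forall F : I -> R,
    \sum_(i < k + l) a i * F (r i) =
    \sum_(i < k) b i * F (t i) + x * \sum_(i < l) c i * F (u i).
Proof.
exists (fun i => match fintype.split i with inl j => b j | inr j => x * c j end).
exists (fun i => match fintype.split i with inl j => t j | inr j => u j end) => F.
rewrite big_split_ord/=; congr (_ + _).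
  by apply: eq_bigr => i _; rewrite (unsplitK (inl _ i)).
rewrite mulr_sumr; apply: eq_bigr => i _.
by rewrite (unsplitK (inr _ i)) mulrA.
Qed.

Section path_events.
Context {R : realType} {I : Type}.

(** The base class of the closure: nonnegative, stable under products, and with expectations that
    are values of moment generating functions. *)
Definition exp_comb : set ((I -> R) -> R) :=
  [set f | exists k (b : 'I_k -> R) (t : 'I_k -> I),
    f = fun s => expR (\sum_(i < k) b i * s (t i))].

Lemma exp_comb_ge0 f : exp_comb f -> forall s, 0 <= f s.
Proof. by move=> [k [b [t ->]]] s; exact: expR_ge0. Qed.

Lemma exp_combM f g : exp_comb f -> exp_comb g -> exp_comb (fun s => f s * g s).
Proof.
move=> [k [b [t ->]]] [l [c [u ->]]].
have [a [r ar]] := lincomb_add b t c u 1.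
by exists (k + l)%N, a, r; apply/funext => s; rewrite ar mul1r expRD.
Qed.

Lemma exp_comb1 (a : R) (t : I) : exp_comb (fun s => expR (a * s t)).
Proof. by exists 1%N, (fun=> a), (fun=> t); apply/funext => s; rewrite big_ord1. Qed.

Local Notation dc := (dclosure exp_comb).

Lemma exp_dclosure_mul f g : dc f -> dc g -> dc (fun s => f s * g s).
Proof. exact: dclosureM exp_comb_ge0 exp_combM. Qed.

Lemma exp_dclosure_one : dc (fun=> 1).
Proof.
apply: dclosure_base; exists 0%N, (fun=> 0).
have u : 'I_0 -> I by case.
by exists u; apply/funext => s; rewrite big_ord0 expR0.
Qed.

Lemma exp_dclosure_cst c : dc (fun=> c).
Proof.
rewrite (_ : (fun=> c) = fun=> (c - 1) * 1 + 1).
  by apply: dclosure_lin; exact: exp_dclosure_one.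
by apply/funext => s; rewrite mulr1 subrK.
Qed.

Lemma exp_dclosure_scale a f : dc f -> dc (fun s => a * f s).
Proof. by move=> ?; apply: exp_dclosure_mul => //; exact: exp_dclosure_cst. Qed.

Lemma exp_dclosure_add f g : dc f -> dc g -> dc (fun s => f s + g s).
Proof.
move=> df dg; rewrite (_ : (fun s => _) = fun s => 1 * f s + g s).
  exact: dclosure_lin.
by apply/funext => s; rewrite mul1r.
Qed.

Lemma exp_dclosure_exp n f : dc f -> dc (fun s => f s ^+ n).
Proof.
move=> df; elim: n => [|n IH]; first exact: exp_dclosure_one.
rewrite (_ : (fun s => _) = fun s => f s * f s ^+ n); first exact: exp_dclosure_mul.
by apply/funext => s; rewrite exprS.
Qed.

Lemma exp_dclosure_sum n (f : nat -> (I -> R) -> R) : (forall i, dc (f i)) ->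
  dc (fun s => \sum_(0 <= i < n) f i s).
Proof.
move=> df; elim: n => [|n IH].
  rewrite (_ : (fun s => _) = fun=> 0); first exact: exp_dclosure_cst.
  by apply/funext => s; rewrite big_nil.
rewrite (_ : (fun s => _) = fun s => (\sum_(0 <= i < n) f i s) + f n s).
  exact: exp_dclosure_add.
by apply/funext => s; rewrite big_nat_recr.
Qed.

Lemma exp_dclosure_bounded_lim (f_ : nat -> (I -> R) -> R) f : (forall n, dc (f_ n)) ->
  (forall n s, 0 <= f_ n s <= 1) -> (forall s, f_ n s @[n --> \oo] --> f s) -> dc f.
Proof.
move=> df_ f_1 f_f; apply: (dclosure_lim df_ exp_dclosure_one _ f_f) => n s.
by have /andP[? ?] := f_1 n s; rewrite ger0_norm.
Qed.

(** The coordinate is the limit of scaled differences of exponentials, and the bound is a sum of two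
    exponentials from the base class. *)
Lemma exp_dclosure_coord (t : I) : dc (fun s => s t).
Proof.
pose f_ n (s : I -> R) := n.+1%:R * (expR (s t / n.+1%:R) - 1).
apply: (@dclosure_lim _ _ _ f_ _ (fun s => expR (2 * s t) + expR (- 2 * s t))).
- move=> n; apply: exp_dclosure_scale; apply: exp_dclosure_add; last exact: exp_dclosure_cst.
  rewrite (_ : (fun s => _) = fun s => expR (n.+1%:R^-1 * s t)).
    exact/dclosure_base/exp_comb1.
  by apply/funext => s; rewrite mulrC.
- by apply: exp_dclosure_add; apply/dclosure_base; exact: exp_comb1.
- move=> n s; rewrite mulNr (le_trans _ (expR_norm_le _))//.
  by rewrite [`|2 * _|]normrM normr_nat norm_scaled_expR_sub1_le.
- by move=> s; exact: cvg_expR_sub1.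
Qed.

(** The Taylor polynomials of the sine at [f] are in the closure and are dominated by [expR |f|],
    hence by [g]. *)
Lemma exp_dclosure_sin f g : dc f -> dc g -> (forall s, expR `|f s| <= g s) ->
  dc (fun s => sin (f s)).
Proof.
move=> df dg fg.
apply: (@dclosure_lim _ _ _ (fun n s => series (sin_coeff (f s)) n) _ g) => //.
- move=> n; apply: exp_dclosure_sum => i; rewrite /sin_coeff/=.
  rewrite (_ : (fun s => _) = fun s =>
    ((odd i)%:R * (-1) ^+ i.-1./2 / i`!%:R) * f s ^+ i).
    by apply: exp_dclosure_scale; exact: exp_dclosure_exp.
  by apply/funext => s; rewrite mulrAC.
- by move=> n s; rewrite (le_trans (norm_series_sin_coeff _ _)).
- by move=> s; rewrite unlock; exact: is_cvg_series_sin_coeff.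
Qed.

Lemma exp_dclosure_half_step f : dc f -> (forall s, 0 <= f s <= 1) ->
  dc (fun s => half_step (f s)).
Proof.
move=> df f01.
apply: (exp_dclosure_bounded_lim _ (fun n s => smoothstep_itv n (f01 s))
  (fun s => cvg_smoothstep (f01 s))).
elim=> //= n IH; apply: exp_dclosure_add; first by apply: exp_dclosure_scale; exact: exp_dclosure_exp.
rewrite (_ : (fun s => _) = fun s => - 2 *
  iter n (fun x => 3 * x ^+ 2 - 2 * x ^+ 3) (f s) ^+ 3).
  by apply: exp_dclosure_scale; exact: exp_dclosure_exp.
by apply/funext => s; rewrite mulNr.
Qed.

(* With [v = a * s t - c], [sin (v / n.+1)] eventually has the sign of [v];
   [half_step] turns the sign into [g] with values 0, 1/2, 1, and [2 g^2 - g]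
   removes the value 1/2. *)
Lemma exp_dclosure_gt (a c : R) (t : I) : dc (\1_[set s | c < a * s t]).
Proof.
pose v n (s : I -> R) := n.+1%:R^-1 * (a * s t - c).
pose y n s := 2^-1 * (1 + sin (v n s)).
have dv n : dc (v n).
  apply/exp_dclosure_scale/exp_dclosure_add; last exact: exp_dclosure_cst.
  exact/exp_dclosure_scale/exp_dclosure_coord.
have dexp (b e : R) : dc (fun s => expR (b * (a * s t) + e)).
  rewrite (_ : (fun s => _) = fun s => expR e * expR ((b * a) * s t)).
    exact/exp_dclosure_scale/dclosure_base/exp_comb1.
  by apply/funext => s; rewrite expRD mulrC mulrA.
have dsin n : dc (fun s => sin (v n s)).
  apply: (@exp_dclosure_sin _ (fun s => expR (v n s) + expR (- v n s))) => //.
    apply: exp_dclosure_add.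
      rewrite (_ : (fun s => _) = fun s => expR (n.+1%:R^-1 * (a * s t) + - (n.+1%:R^-1 * c)))//.
      by apply/funext => s; rewrite /v mulrBr.
    rewrite (_ : (fun s => _) = fun s => expR (- n.+1%:R^-1 * (a * s t) + (n.+1%:R^-1 * c)))//.
    by apply/funext => s; rewrite /v mulrBr mulNr opprB addrC.
  by move=> s; exact: expR_norm_le.
have dy n : dc (fun s => half_step (y n s)).
  apply: exp_dclosure_half_step => [|s].
    by apply/exp_dclosure_scale/exp_dclosure_add => //; exact: exp_dclosure_one.
  rewrite /y; have := sin_le1 (v n s); have := sin_geN1 (v n s).
  by move=> ? ?; apply/andP; split; lra.
pose g (s : I -> R) : R := if a * s t < c then 0 else if a * s t == c then 2^-1 else 1.
have hs (x : R) : 0 <= half_step x <= 1.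
  by rewrite /half_step; case: ifP => _; [|case: ifP => _]; apply/andP; split; lra.
have dg : dc g.
  apply: (exp_dclosure_bounded_lim dy (fun n s => hs _)) => s.
  apply: cvg_near_cst.
  (* Beyond [N] the argument lies in [(-1, 1)], hence within [(-pi, pi)], where the sine has the
     sign of its argument; the sequence is then constant. *)
  have [N Ns] : exists N, forall n, (N <= n)%N -> `|v n s| < 1.
    have := archi_boundP (normr_ge0 (a * s t - c)).
    set N := Num.bound _ => hN; exists N => n Nn.
    rewrite /v normrM ger0_norm ?invr_ge0// mulrC ltr_pdivrMr// mul1r.
    by rewrite (lt_le_trans hN)// ler_nat ltnW.
  exists N => // n /= /Ns vn.
  have pi1 : 1 < pi :> R by rewrite (lt_le_trans _ (pi_ge2 R))// ltr1n.
  rewrite /half_step /y /g.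
  have [e|e|e] := ltgtP (a * s t) c.
  - have v0 : v n s < 0 by rewrite /v pmulr_rlt0 ?invr_gt0// subr_lt0.
    have : sin (v n s) < 0.
      rewrite -oppr_gt0 -sinN sin_gt0_pi// oppr_gt0 v0/=.
      by move: vn; rewrite ltr0_norm// => vn; exact: lt_trans pi1.
    by move=> ?; rewrite ifT//; lra.
  - have v0 : 0 < v n s by rewrite /v mulr_gt0 ?invr_gt0// subr_gt0.
    have : 0 < sin (v n s).
      rewrite sin_gt0_pi// v0/=.
      by move: vn; rewrite gtr0_norm// => vn; exact: lt_trans pi1.
    by move=> ?; rewrite ifF ?ifF//; [apply/negbTE/eqP|apply/negbTE]; lra.
  - have -> : v n s = 0 by rewrite /v e subrr mulr0.
    by rewrite sin0 addr0 mulr1 ltxx eqxx.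
rewrite (_ : \1__ = fun s => 2 * g s ^+ 2 + (- 1) * g s).
  by apply: exp_dclosure_add; apply: exp_dclosure_scale => //; exact: exp_dclosure_exp.
apply/funext => s; rewrite indicE /g.
have [e|e|e] := ltgtP.
- by rewrite memNset/= ?mulr0 ?expr0n/= ?mulr0 ?addr0//; apply/negP; rewrite -leNgt ltW.
- by rewrite mem_set//=; lra.
- by rewrite memNset/= ?e ?ltxx//; lra.
Qed.

Lemma exp_dclosure_setC (A : set (I -> R)) : dc \1_A -> dc \1_(~` A).
Proof.
move=> dA; rewrite (_ : \1__ = fun s => 1 + (-1) * \1_A s).
  by apply: exp_dclosure_add; [exact: exp_dclosure_one|exact: exp_dclosure_scale].
by apply/funext => s; rewrite !indicE in_setC; case: (_ \in _) => /=; lra.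
Qed.

Lemma exp_dclosure_setI (A B : set (I -> R)) : dc \1_A -> dc \1_B -> dc \1_(A `&` B).
Proof. by move=> dA dB; rewrite indicI; exact: exp_dclosure_mul. Qed.

(** Indicators of finite intersections are products; at each path they are eventually constant, with
    the indicator of the whole intersection as limit. *)
Lemma exp_dclosure_bigcap (A : nat -> set (I -> R)) :
  (forall n, dc \1_(A n)) -> dc \1_(\bigcap_n A n).
Proof.
move=> dA.
apply: (@exp_dclosure_bounded_lim (fun n => \1_(\bigcap_(i < n) A i))).
- elim=> [|n IH].
    rewrite bigcap_mkord big_ord0 indicT; exact: exp_dclosure_one.
  by rewrite bigcap_mkord big_ord_recr/= -bigcap_mkord; exact: exp_dclosure_setI.
- by move=> n s; rewrite indicE; case: (_ \in _) => /=; apply/andP; split; lra.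
- move=> s; apply: cvg_near_cst; have [As|] := pselect ((\bigcap_n A n) s).
    apply: nearW => n; rewrite !indicE !mem_set// => i _; exact: As.
  move=> As; have [N AN] : exists N, ~ A N s.
    by apply/existsNP => h; apply: As => i _; exact: h.
  exists N.+1 => // n /= Nn; rewrite !indicE !memNset// => h.
  by apply: AN; exact: h.
Qed.

(** Each two-sided bound is an intersection of two complements of open half-spaces, with
    coefficients 1 and -1. *)
Lemma exp_dclosure_close (D : nat -> I) (w : I -> R) (r : R) :
  dc \1_[set s | forall n, `|s (D n) - w (D n)| <= r].
Proof.
pose A n := (~` [set s : I -> R | w (D n) + r < 1 * s (D n)]) `&`
            (~` [set s : I -> R | r - w (D n) < (-1) * s (D n)]).
rewrite (_ : [set s | _] = \bigcap_n A n).
  by apply: exp_dclosure_bigcap => n; apply: exp_dclosure_setI; apply: exp_dclosure_setC; exact: exp_dclosure_gt.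
apply/seteqP; split=> s /= h n => [_|].
  have := h n; rewrite ler_norml => /andP[? ?].
  by split=> /=; apply/negP; rewrite -leNgt; lra.
have [] := h n Logic.I; move=> /= /negP + /negP; rewrite -!leNgt ler_norml.
by move=> ? ?; apply/andP; split; lra.
Qed.

End path_events.

(** * Moment generating functions of Gaussian variables *)

Section normal_mgf.
Context {R : realType}.
Local Notation mu := (@lebesgue_measure R).

(* [normal_prob] is a measure on [measurableTypeR R], whose display differs from
   the one of [R]. *)
Lemma ge0_integral_normal_prob (m s : R) (f : R -> \bar R) :
  (forall x, 0 <= f x)%E -> measurable_fun [set: R] f ->
  (\int[normal_prob m s]_x f x = \int[mu]_x (f x * (normal_pdf m s x)%:E))%E.
Proof.
move=> f0 mf.
have dom : normal_prob m s `<< mu := @normal_prob_dominates R m s.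
rewrite -(Radon_Nikodym_SigmaFinite.change_of_variables dom)//.
have ir : mu.-integrable [set: R] (Radon_Nikodym_SigmaFinite.f (normal_prob m s) mu).
  exact: Radon_Nikodym_SigmaFinite.f_integrable.
apply: ae_eq_integral => //.
- by apply: emeasurable_funM => //; exact: measurable_int ir.
- by apply: emeasurable_funM => //; apply: measurableT_comp => //; exact: measurable_normal_pdf.
- apply: ae_eqe_mul2l; apply: integral_ae_eq => //.
  + by apply: measurableT_comp => //; exact: measurable_normal_pdf.
  + by move=> A _ mA; rewrite -Radon_Nikodym_SigmaFinite.f_integral.
Qed.

Lemma normal_prob_mgf (m s a : R) : s != 0 ->
  (\int[normal_prob m s]_x (expR (a * x))%:E
   = (expR (a * m + a ^+ 2 * s ^+ 2 / 2))%:E)%E.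
Proof.
move=> s0; rewrite ge0_integral_normal_prob; last 2 first.
- by move=> x; rewrite lee_fin expR_ge0.
- by apply/measurable_EFinP; apply: measurableT_comp => //; exact: measurable_funM.
(* Completing the square: the exponential times the density is the right-hand constant times the
   normal density with mean shifted to [m + a * s ^+ 2]. *)
rewrite -[RHS]mule1 -(integral_normal_pdf (m + a * s ^+ 2) s) -integralZl//; last first.
  exact: integrable_normal_pdf.
apply: eq_integral => x _; rewrite -!EFinM; congr EFin.
rewrite !normal_pdfE// /normal_fun mulrCA [RHS]mulrCA; congr (_ * _).
rewrite -!expRD; congr expR; field.
by rewrite s0.
Qed.

Lemma gaussian_mgf (dO : measure_display) (Omega : measurableType dO)
    (P : probability Omega R) (X : Omega -> R) :
  measurable_fun [set: Omega] X -> is_gaussian P X ->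
  exists m s : R, forall a : R,
    (\int[P]_w (expR (a * X w))%:E = (expR (a * m + a ^+ 2 * s ^+ 2 / 2))%:E)%E.
Proof.
move=> mX [m [s [s0 lawX]]]; exists m, s => a.
have me : measurable_fun [set: measurableTypeR R] (fun x => (expR (a * x))%:E).
  by apply/measurable_EFinP; apply: measurableT_comp => //; exact: measurable_funM.
have := @ge0_integral_pushforward _ _ _ (measurableTypeR R) R X mX P setT _ measurableT me.
rewrite preimage_setT => /(_ (fun x _ => expR_ge0 _)) <-.
(* The Dirac law obeys the same formula with [s = 0], so both cases share one expression. *)
move: lawX; rewrite /gaussian_law; case: eqVneq => [->|sN0] lawX.
  rewrite (eq_measure_integral (\d_(m : measurableTypeR R)))/=; last by move=> A mA _; exact: lawX.
  by rewrite integral_dirac// diracT mul1e expr0n/= mulr0 mul0r addr0.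
rewrite -(normal_prob_mgf m a sN0).
by apply: eq_measure_integral => A mA _; exact: lawX.
Qed.

End normal_mgf.

(** * Mean and second moment from the moment generating function *)

Lemma integrable_sqr_Lfun2 d (T : measurableType d) (R : realType)
    (m : {measure set T -> \bar R}) (f : T -> R) :
  measurable_fun [set: T] f ->
  m.-integrable [set: T] (EFin \o (fun x => f x ^+ 2)) -> f \in Lfun m 2%:E.
Proof.
move=> mf /integrableP[_ f2].
rewrite inE; apply/andP; split; rewrite inE//=.
rewrite /finite_norm unlock poweR_lty//.
apply: le_lt_trans f2; rewrite le_eqVlt; apply/orP; left; apply/eqP.
by apply: eq_integral => x _ /=; rewrite powR_mulrn// normrX.
Qed.

Section moments_of_mgf.
Local Open Scope ereal_scope.
Context {R : realType} d (T : measurableType d) (P : probability T R).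
Variables (Z : T -> R) (c : R).
Hypothesis mZ : measurable_fun [set: T] Z.
Hypothesis mgfZ : forall a : R, \int[P]_w (expR (a * Z w))%:E = (expR (a ^+ 2 * c))%:E.

Let scaled n (x : R) : R := (n.+1%:R * (expR (x / n.+1%:R) - 1))%R.

Let iZ a : P.-integrable [set: T] (EFin \o (fun w => expR (a * Z w))).
Proof.
have m : measurable_fun [set: T] (fun w => expR (a * Z w)).
  by apply: measurableT_comp => //; exact: measurable_funM.
apply/integrableP; split; first exact/measurable_EFinP.
under eq_integral do rewrite /= ger0_norm ?expR_ge0//.
by rewrite mgfZ ltry.
Qed.

Let iZ2 a : P.-integrable [set: T] (EFin \o (fun w => expR (a * Z w) + expR (- (a * Z w)))%R).
Proof.
have := iZ (- a); under eq_fun do rewrite mulNr; move=> iN.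
exact: (integrableD measurableT (iZ a) iN).
Qed.

Let m_scaled n (a : R) : measurable_fun [set: T] (fun w => scaled n (a * Z w)%R).
Proof.
apply: measurable_funM => //; apply: measurable_funB => //.
apply: measurableT_comp => //; apply: measurable_funM => //.
exact: measurable_funM.
Qed.

(** [Z] is the limit of symmetric difference quotients of exponentials, each of mean zero because
    the moment generating function is even. *)
Lemma mgf_mean : P.-integrable [set: T] (EFin \o Z) /\ \int[P]_w (Z w)%:E = 0.
Proof.
pose f_ n w : R := (2^-1 * (scaled n (Z w) - scaled n (- Z w)))%R.
have mf_ n : measurable_fun [set: T] (f_ n).
  apply: measurable_funM => //; apply: measurable_funB.
    by have := m_scaled n 1; under eq_fun do rewrite mul1r.
  by have := m_scaled n (-1); under eq_fun do rewrite mulN1r.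
have [] := @dominated_convergence _ _ _ P _ measurableT
    (fun n => EFin \o f_ n) (EFin \o Z) _ _ _ _ (iZ2 2).
- by move=> n; exact/measurable_EFinP.
- exact/measurable_EFinP.
- apply/aeW => w _; apply/fine_cvgP; split; first exact: nearW.
  rewrite (_ : Z w = 2^-1 * (Z w - - Z w))%R; last by lra.
  apply: cvgM; first exact: cvg_cst.
  by apply: cvgB; exact: cvg_expR_sub1.
- apply/aeW => w n _ /=; rewrite lee_fin.
  rewrite (le_trans _ (expR_norm_le _))// [`|2 * _|%R]normrM normr_nat.
  rewrite normrM ger0_norm// ler_pdivrMl// (le_trans (ler_normB _ _))//.
  have := norm_scaled_expR_sub1_le n (Z w).
  have := norm_scaled_expR_sub1_le n (- Z w); rewrite normrN /scaled.
  by move=> ? ?; lra.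
move=> i1 _ h; split => //; apply/esym/(cvg_unique _ _ h) => //.
rewrite (_ : (fun n => _) = fun=> 0); first exact: cvg_cst.
apply/funext => n /=.
transitivity (\int[P]_w ((n.+1%:R / 2 * expR (n.+1%:R^-1 * Z w))%:E
   - (n.+1%:R / 2 * expR (- n.+1%:R^-1 * Z w))%:E)).
  apply: eq_integral => w _; rewrite -EFinB; congr EFin.
  by rewrite /f_ /scaled mulNr mulNr (mulrC (Z w)); lra.
rewrite integralB//; last 2 first.
- exact: (integrableZl measurableT _ (iZ _)).
- exact: (integrableZl measurableT _ (iZ _)).
under eq_integral do rewrite EFinM.
under [X in _ - X]eq_integral do rewrite EFinM.
rewrite !integralZl//; [|exact: iZ|exact: iZ].
rewrite !mgfZ -!EFinM -EFinB; congr EFin.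
by rewrite sqrrN subrr.
Qed.

(** [Z ^+ 2] is the limit of squared difference quotients. With [k = n.+1], the square expands to
    [k^2 (e^(2Z/k) - 2 e^(Z/k) + 1)], whose expectation tends to [4c - 2c]. *)
Lemma mgf_second_moment :
  P.-integrable [set: T] (EFin \o (fun w => Z w ^+ 2)%R) /\
  \int[P]_w (Z w ^+ 2)%:E = (2 * c)%:E.
Proof.
pose f_ n w : R := (scaled n (Z w) ^+ 2)%R.
have mf_ n : measurable_fun [set: T] (f_ n).
  apply: measurable_funX.
  by have := m_scaled n 1; under eq_fun do rewrite mul1r.
have [] := @dominated_convergence _ _ _ P _ measurableT
    (fun n => EFin \o f_ n) (EFin \o (fun w => Z w ^+ 2)%R) _ _ _ _ (iZ2 4).
- by move=> n; exact/measurable_EFinP.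
- exact/measurable_EFinP/measurable_funX.
- apply/aeW => w _; apply/fine_cvgP; split; first exact: nearW.
  by rewrite expr2; apply: cvgM; exact: cvg_expR_sub1.
- apply/aeW => w n _ /=; rewrite lee_fin.
  rewrite (le_trans _ (expR_norm_le _))// [`|4 * _|%R]normrM normr_nat normrX.
  rewrite (_ : 4 * `|Z w| = 2 * `|Z w| + 2 * `|Z w|)%R; last by lra.
  by rewrite expRD expr2; apply: ler_pM => //; exact: norm_scaled_expR_sub1_le.
move=> i1 _ h; split => //; apply/esym/(cvg_unique _ _ h) => //.
rewrite (_ : (fun n => _) = fun n => ((n.+1 ^ 2)%:R * (expR (4 * c / (n.+1 ^ 2)%:R) - 1)
   - 2 * ((n.+1 ^ 2)%:R * (expR (c / (n.+1 ^ 2)%:R) - 1)))%:E); last first.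
  apply/funext => n /=; set k : R := n.+1%:R.
  have k0 : (k != 0)%R by rewrite pnatr_eq0.
  transitivity (\int[P]_w (((k ^+ 2 * expR (2 / k * Z w))%:E
     - (2 * k ^+ 2 * expR (k^-1 * Z w))%:E) + (k ^+ 2)%:E)).
    apply: eq_integral => w _; rewrite -EFinB -EFinD; congr EFin.
    have -> : (2 / k * Z w = Z w / k + Z w / k)%R by field.
    by rewrite /f_ /scaled -/k expRD (mulrC _ (Z w)); ring.
  have ik := integrableZl measurableT (k ^+ 2) (iZ (2 / k)).
  have ik' := integrableZl measurableT (2 * k ^+ 2) (iZ (k^-1)).
  rewrite integralD//; last 2 first.
  - exact: (integrableB measurableT ik ik').
  - exact: finite_measure_integrable_cst.
  rewrite integralB//.
  under eq_integral do rewrite EFinM.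
  under [X in _ - X + _]eq_integral do rewrite EFinM.
  rewrite !integralZl//; [|exact: iZ|exact: iZ].
  rewrite !mgfZ integral_cst//= probability_setT mule1.
  rewrite -!EFinM -EFinB -EFinD; congr EFin.
  rewrite natrX -/k.
  have -> : ((2 / k) ^+ 2 * c = 4 * c / k ^+ 2)%R by field.
  have -> : (k^-1 ^+ 2 * c = c / k ^+ 2)%R by field.
  ring.
apply/fine_cvgP; split; first exact: nearW.
have sub (x : R) : ((n.+1 ^ 2)%:R * (expR (x / (n.+1 ^ 2)%:R) - 1))%R @[n --> \oo] --> x.
  (* A subsequence of the basic limit; the predecessor compensates the successor inside [scaled]. *)
  rewrite (_ : (fun n => _) = (fun n => scaled n x) \o (fun n => (n.+1 ^ 2).-1)).
    apply: (cvg_comp (fun n => (n.+1 ^ 2).-1) _ _ (@cvg_expR_sub1 R x)).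
    move=> A [N _ NA].
    exists N => // n /= Nn; suff nN : (N <= (n.+1 ^ 2).-1)%N by exact: NA nN.
    have n2 : (0 < n.+1 ^ 2)%N by rewrite expn_gt0.
    by rewrite -ltnS (prednK n2) (leq_ltn_trans Nn)// (leq_trans (ltnSn _))// leq_pmulr.
  by apply/funext => n; rewrite /comp /scaled prednK ?expn_gt0.
rewrite (_ : 2 * c = 4 * c - 2 * c)%R; last by lra.
by apply: cvgB; [exact: sub|apply: cvgM; [exact: cvg_cst|exact: sub]].
Qed.

End moments_of_mgf.

(** The centred variable has [c = s ^+ 2 / 2] in the moment lemmas, which identifies the parameters
    of the law with the mean and the variance. *)
Lemma gaussian_mgfE (R : realType) (dO : measure_display) (Omega : measurableType dO)
    (P : probability Omega R) (X : Omega -> R) :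
  measurable_fun [set: Omega] X -> is_gaussian P X ->
  X \in Lfun P 2%:E /\ forall a : R, (\int[P]_w (expR (a * X w))%:E =
    (expR (a * fine 'E_P[X] + a ^+ 2 * fine 'V_P[X] / 2))%:E)%E.
Proof.
move=> mX /(gaussian_mgf mX)[m [s mgfX]].
pose Z w := X w - m.
have mZ : measurable_fun [set: Omega] Z by exact: measurable_funB.
have mgfZ a : (\int[P]_w (expR (a * Z w))%:E = (expR (a ^+ 2 * (s ^+ 2 / 2)))%:E)%E.
  transitivity (\int[P]_w ((expR (- (a * m)))%:E * (expR (a * X w))%:E))%E.
    apply: eq_integral => w _; rewrite -EFinM -expRD; congr (expR _)%:E.
    by rewrite /Z; lra.
  rewrite ge0_integralZl ?lee_fin ?expR_ge0//.
    by rewrite mgfX -EFinM -expRD; congr (expR _)%:E; lra.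
  by apply/measurable_EFinP; apply: measurableT_comp => //; exact: measurable_funM.
have [iZ EZ] := mgf_mean mZ mgfZ.
have [iZ2 EZ2] := mgf_second_moment mZ mgfZ.
have Z2 : Z \in Lfun P 2%:E by exact: integrable_sqr_Lfun2.
have XE : X = Z \+ cst m by apply/funext => w; rewrite /Z /= subrK.
have X2 : X \in Lfun P 2%:E by rewrite XE rpredD ?lee1n//= => _; exact: Lfun_cst.
have EX : 'E_P[X]%E = m%:E.
  rewrite XE expectationD ?expectation_cst; last 2 first.
  - exact/Lfun1_integrable.
  - exact: Lfun_cst.
  by rewrite unlock EZ add0e.
have VX : 'V_P[X]%E = (s ^+ 2)%:E.
  rewrite XE varianceD_cst_r// varianceE// unlock EZ expe2 mule0 sube0.
  rewrite -[RHS]/((s ^+ 2)%:E) (_ : s ^+ 2 = 2 * (s ^+ 2 / 2)); last by lra.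
  by rewrite -EZ2.
by split => // a; rewrite mgfX EX VX.
Qed.

(** * Countable description of continuous paths *)

(** A filter on the subtype is pushed forward to [X]. Its cluster point lies in [A], and
    neighbourhoods in the subtype are traces of those in [X]. *)
Lemma compact_set_type (X : topologicalType) (A : set X) :
  compact A -> compact [set: A].
Proof.
move=> cA F PF _.
have [|x [Ax xF]] := cA (set_val @ F) _.
  by apply: (@filterS _ F _ setT) => [a _ /=|]; [exact: set_valP|exact: filterT].
have xA : x \in A by rewrite inE.
exists (exist _ x xA); split => // B C FB /= nC.
move: nC => [_ [[V oV <-] /= Vx VC]].
have [|y [[a Ba <-] Va]] := xF (set_val @` B) V _ (open_nbhs_nbhs (conj oV Vx)).
  by apply: (@filterS _ F _ B) => // a Ba /=; exists a.
by exists a; split => //; exact: VC.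
Qed.

Lemma compact_second_countable_set_type (R : realType) (X : pseudoMetricType R)
    (A : set X) : compact A -> @second_countable A.
Proof.
move=> /compact_set_type cA.
have [[x _]|A0] := pselect (exists x : A, True).
  pose Y := HB.pack_for (pseudoPMetricType R) (set_type A)
    (isPointed.Build (set_type A) x).
  exact: (@compact_second_countable R Y cA).
exists set0; first exact: countable0.
by split => // x; exfalso; apply: A0; exists x.
Qed.

(** [U] enumerates a countable base and [D] picks a point in each nonempty [U n], with [x0] as
    default. The enumeration is only known to cover the base, hence openness is claimed for the
    chosen index alone. *)
Lemma second_countable_dense_seq (X : topologicalType) (x0 : X) :
  @second_countable X -> exists (U : nat -> set X) (D : nat -> X),
    (forall x V, nbhs x V -> exists n, [/\ open (U n), U n x & U n `<=` V]) /\
    (forall n, U n !=set0 -> U n (D n)).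
Proof.
move=> [B /pcard_surjP[U BU] [oB nB]].
have hD n : exists x, U n !=set0 -> U n x.
  by have [[x Ux]|Un] := pselect (U n !=set0); [exists x|exists x0 => /Un].
exists U, (fun n => projT1 (cid (hD n))); split=> [x V xV|n].
  have [W [BW Wx] WV] := nB x V xV.
  by have [n _ nW] := BU W BW; exists n; rewrite nW; split=> //; exact: oB.
exact: (projT2 (cid (hD n))).
Qed.

Section dense_seq.
Context {R : realType} {X : topologicalType}.
Variables (U : nat -> set X) (D : nat -> X).
Hypothesis U_basis : forall x V, nbhs x V -> exists n, [/\ open (U n), U n x & U n `<=` V].
Hypothesis D_dense : forall n, U n !=set0 -> U n (D n).

Lemma dense_seq_le (f : X -> R) (r : R) : continuous f ->
  (forall n, f (D n) <= r) -> forall x, f x <= r.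
Proof.
move=> cf fD x; rewrite leNgt; apply/negP => rfx.
have /U_basis[n [_ Ux Ur]] : nbhs x [set y | r < f y].
  exact: (cvgr_gt _ (cf x)).
have := fD n; rewrite leNgt => /negP; apply; apply: Ur.
by apply: D_dense; exists x.
Qed.

(* A pair [(n, q)] of a code records that the path is close to [q] on [U n]. *)
Definition oscillation_code (l : seq (nat * rat)) :=
  forall x, exists2 p, p \in l & U p.1 x.

(** Tested only along [D], so that for a random path it is a countable intersection of measurable
    events. *)
Definition has_oscillation_code (l : seq (nat * rat)) (eta : R) (f : X -> R) :=
  forall p n, p \in l -> U p.1 (D n) -> `|f (D n) - ratr p.2| <= eta.

Lemma continuous_oscillation_code (eta : R) (f : X -> R) :
  0 < eta -> compact [set: X] -> continuous f ->
  exists2 l, oscillation_code l & has_oscillation_code l eta f.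
Proof.
move=> eta0 cX cf.
have h x : exists p : nat * rat, [/\ open (U p.1), U p.1 x &
    forall y, U p.1 y -> `|f y - ratr p.2| <= eta].
  (* The tolerance is halved: [q] is within [eta / 2] of [f x], and [f] varies by less than
     [eta / 2] on the basic set. *)
  have [q] : exists q, ratr q \in `](f x - eta / 2), (f x + eta / 2)[.
    by apply: rat_in_itvoo; lra.
  rewrite in_itv/= => /andP[q1 q2].
  have /U_basis[n [oU Ux Un]] : nbhs x [set y | `|f x - f y| < eta / 2].
    by apply: (@cvgr_dist_lt _ _ _ (nbhs x) _ f _ (cf x)); rewrite divr_gt0.
  exists (n, q); split => //= y /Un /=.
  rewrite !ltr_norml ler_norml => /andP[? ?].
  by apply/andP; split; lra.
pose g x := projT1 (cid (h x)).
have gP x := projT2 (cid (h x)).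
have [F _ FX] : finite_subset_cover [set: X] (fun x => U (g x).1) [set: X].
  pose Y := HB.pack_for ptopologicalType (Topological.sort X)
    (isPointed.Build (Topological.sort X) (D 0)).
  have : @cover_compact Y setT by rewrite -compact_cover.
  apply => [x _|x _]; first by have [] := gP x.
  by exists x => //; have [] := gP x.
exists [seq g x | x <- finmap.enum_fset F] => [x|p n /mapP[x _ ->]].
  have [y /= yF Uyx] := FX x Logic.I.
  by exists (g y) => //; exact: map_f.
by have [_ _] := gP x; exact.
Qed.

Lemma oscillation_code_dist (l : seq (nat * rat)) (eta : R) (f g : X -> R) n :
  oscillation_code l -> has_oscillation_code l eta f ->
  has_oscillation_code l eta g -> `|f (D n) - g (D n)| <= 2 * eta.
Proof.
move=> /(_ (D n))[p pl Up] /(_ p n pl Up) fl /(_ p n pl Up) gl.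
by move: fl gl; rewrite !ler_norml => /andP[? ?] /andP[? ?]; apply/andP; split; lra.
Qed.

Lemma close_paths_event (d : measure_display) (T : measurableType d)
    (P : probability T R) (A : X -> T -> R) (eta : R) :
  0 < eta -> compact [set: X] ->
  (forall x, measurable_fun [set: T] (A x)) ->
  (forall w, continuous (A ^~ w)) ->
  exists E : set T, [/\ measurable E, (0 < P E)%E &
    forall w w' n, E w -> E w' -> `|A (D n) w - A (D n) w'| <= 2 * eta].
Proof.
move=> eta0 cX mA cA.
(* Lists of pairs are enumerated by [nat]; numbers that encode no list give the empty event. *)
pose E k := if unpickle k is Some l then
  [set w | oscillation_code l /\ has_oscillation_code l eta (A ^~ w)] else set0.
have mE k : measurable (E k).
  rewrite /E; case: unpickle => // l.
  have [cl|cl] := pselect (oscillation_code l); last first.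
    by rewrite (_ : [set w | _] = set0)//; apply/seteqP; split => // w [].
  rewrite (_ : [set w | _] = \bigcap_n \bigcap_(p in [set` l])
      [set w | U p.1 (D n) -> `|A (D n) w - ratr p.2| <= eta]); last first.
    apply/seteqP; split=> [w [_ h] n _ p /= pl|w h]; first exact: h.
    by split => // p n pl; apply: h.
  apply: bigcapT_measurable => n; apply: fin_bigcap_measurable => // p _.
  have [Up|Up] := pselect (U p.1 (D n)); last first.
    by rewrite (_ : [set w | _] = setT)//; apply/seteqP; split => // w _ /Up.
  rewrite (_ : [set w | _] = [set: T] `&`
      (fun w => `|A (D n) w - ratr p.2|) @^-1` `]-oo, eta]).
    have : measurable_fun [set: T] (fun w => `|A (D n) w - ratr p.2|).
      by apply: measurableT_comp => //; exact: measurable_funB.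
    by apply => //; exact: measurable_itv.
  by apply/seteqP; split=> w /=; rewrite in_itv/=; [move=> /(_ Up)|case].
(* Every path has a code, so the events [E k] cover the space and cannot all be null. *)
have [k Ek0] : exists k, P (E k) != 0%E.
  apply: contrapT => /forallNP E0.
  have : P.-negligible (\bigcup_k E k).
    apply: negligible_bigcup => k; apply/negligibleP => //.
    by apply/eqP/negPn/negP; exact: E0.
  rewrite (_ : \bigcup_k E k = setT); last first.
    apply/seteqP; split => // w _.
    have [l cl lw] := continuous_oscillation_code eta0 cX (cA w).
    by exists (pickle l) => //; rewrite /E pickleK.
  move=> /(negligibleP P measurableT) P0.
  by have /eqP := etrans (esym (probability_setT P)) P0; rewrite onee_eq0.
exists (E k); split => //; first by rewrite lt0e Ek0 measure_ge0.
move=> w w' n; rewrite /E; case: unpickle => // l [cl lw] [_ lw'].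
exact: (oscillation_code_dist n cl lw lw').
Qed.

End dense_seq.

(** * Resampling the residual *)

Section lincomb_moments.
Local Open Scope ereal_scope.
Context d (Omega : measurableType d) (R : realType) (P : probability Omega R).
Implicit Type Z : Omega -> R.

Let Pfin : P [set: Omega] \is a fin_num := fin_num_measure P _ measurableT.

Let lincombS k (b : 'I_k.+1 -> R) (Y : 'I_k.+1 -> Omega -> R) :
  (fun w => \sum_(i < k.+1) b i * Y i w)%R =
  ((fun w => \sum_(i < k) b (widen_ord (leqnSn k) i) * Y (widen_ord (leqnSn k) i) w)
   \+ (b ord_max \o* Y ord_max))%R.
Proof. by apply/funext => w; rewrite big_ord_recr/= [(Y _ _ * _)%R]mulrC. Qed.

Let lincomb0 (b : 'I_0 -> R) (Y : 'I_0 -> Omega -> R) :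
  (fun w => \sum_(i < 0) b i * Y i w)%R = cst 0%R.
Proof. by apply/funext => w; rewrite big_ord0. Qed.

Lemma lincomb_Lfun2 k (b : 'I_k -> R) (Y : 'I_k -> Omega -> R) :
  (forall i, Y i \in Lfun P 2%:E) ->
  (fun w => \sum_(i < k) b i * Y i w)%R \in Lfun P 2%:E.
Proof.
elim: k b Y => [|k IH] b Y LY; first by rewrite lincomb0 Lfun_cst.
rewrite lincombS rpredD ?lee1n//= => _; first by apply: IH => i; exact: LY.
by apply: Lfun_scale => //; rewrite ler1n.
Qed.

Lemma lincomb_expectation k (b m : 'I_k -> R) (Y : 'I_k -> Omega -> R) :
  (forall i, Y i \in Lfun P 2%:E) -> (forall i, 'E_P[Y i] = (m i)%:E) ->
  'E_P[fun w => \sum_(i < k) b i * Y i w]%R = (\sum_(i < k) b i * m i)%:E.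
Proof.
elim: k b m Y => [|k IH] b m Y LY EY; first by rewrite lincomb0 expectation_cst big_ord0.
rewrite lincombS expectationD; last 2 first.
- by apply: (Lfun_subset12 Pfin); apply: lincomb_Lfun2 => i; exact: LY.
- by apply: Lfun_scale => //; exact: (Lfun_subset12 Pfin).
rewrite (IH _ (fun i => m (widen_ord (leqnSn k) i))) => [|i|i]; [|exact: LY|exact: EY].
by rewrite expectationZl ?EY ?(Lfun_subset12 Pfin)// big_ord_recr/= EFinD EFinM.
Qed.

Lemma lincomb_covariance k (b c : 'I_k -> R) (Y : 'I_k -> Omega -> R) Z :
  (forall i, Y i \in Lfun P 2%:E) -> Z \in Lfun P 2%:E ->
  (forall i, covariance P (Y i) Z = (c i)%:E) ->
  covariance P (fun w => \sum_(i < k) b i * Y i w)%R Z = (\sum_(i < k) b i * c i)%:E.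
Proof.
move=> + LZ; elim: k b c Y => [|k IH] b c Y LY EY.
  by rewrite lincomb0 covariance_cst_l big_ord0.
rewrite lincombS covarianceDl//; last 2 first.
- by apply: lincomb_Lfun2 => i; exact: LY.
- by apply: Lfun_scale => //; rewrite ler1n.
rewrite (IH _ (fun i => c (widen_ord (leqnSn k) i))) => [|i|i]; [|exact: LY|exact: EY].
rewrite covarianceZl ?EY ?big_ord_recr ?EFinD ?EFinM//=.
- exact: (Lfun_subset12 Pfin).
- exact: (Lfun_subset12 Pfin).
- exact: Lfun2_mul_Lfun1.
Qed.

End lincomb_moments.

(** * Linear combinations of a Gaussian process and their regression residuals *)

Section gaussian_lincomb.
Context (dO : measure_display) (Omega : measurableType dO) (R : realType).
Context (P : probability Omega R) (I : Type) (W : I -> {RV P >-> R}).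
Variables (mu : I -> R) (sigma : I -> I -> R).
Hypotheses (gW : gaussian_process W) (mW : has_mean W mu)
  (cW : has_covariance W sigma).

Let lincomb k (b : 'I_k -> R) (t : 'I_k -> I) : Omega -> R :=
  fun w => \sum_(i < k) b i * W (t i) w.

Lemma measurable_lincomb k (b : 'I_k -> R) (t : 'I_k -> I) :
  measurable_fun [set: Omega] (lincomb b t).
Proof. by apply: measurable_sum => i; exact: measurable_funM. Qed.

Lemma gaussian_process_Lfun2 t : (W t : Omega -> R) \in Lfun P 2%:E.
Proof.
have := gW (fun=> 1) (fun _ : 'I_1 => t).
rewrite (_ : (fun w => _) = W t); last first.
  by apply/funext => w; rewrite big_ord1 mul1r.
by move=> /gaussian_mgfE[].
Qed.

Lemma lincomb_mgf k (b : 'I_k -> R) (t : 'I_k -> I) (c : R) :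
  (\int[P]_w (expR (c * lincomb b t w))%:E =
   (expR (c * (\sum_(i < k) b i * mu (t i)) +
          c ^+ 2 * fine 'V_P[lincomb b t] / 2))%:E)%E.
Proof.
have [_ ->] := gaussian_mgfE (measurable_lincomb b t) (gW b t).
rewrite (@lincomb_expectation _ _ _ P k b (mu \o t) (fun i => W (t i)))//.
by move=> i; exact: gaussian_process_Lfun2.
Qed.

(** For a single coordinate this says that a kernel combination is the covariance of [W t] with the
    matching combination of the process. *)
Lemma lincomb_kernel_covariance k (b : 'I_k -> R) (t : 'I_k -> I)
    l (a : 'I_l -> R) (u : 'I_l -> I) :
  covariance P (lincomb b t) (lincomb a u) =
  (\sum_(i < k) b i * \sum_(j < l) a j * sigma (t i) (u j))%:E.
Proof.
apply: lincomb_covariance => [i||i]; first exact: gaussian_process_Lfun2.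
  by apply: lincomb_Lfun2 => i; exact: gaussian_process_Lfun2.
rewrite covarianceC; apply: lincomb_covariance => [j||j]; try exact: gaussian_process_Lfun2.
by rewrite covarianceC; exact: cW.
Qed.

(* Subtracting from a Gaussian variable its regression on Y lowers the variance
   by the square of the covariance divided by the variance v of Y; when v = 0
   both the quotient and the correction vanish. *)
Lemma residual_mgf k (b : 'I_k -> R) (t : 'I_k -> I)
    l (a : 'I_l -> R) (u : 'I_l -> I) :
  let v := fine 'V_P[lincomb a u] in
  let h := \sum_(i < k) b i * \sum_(j < l) a j * sigma (t i) (u j) in
  exists e : R, forall c : R,
  (\int[P]_w (expR (c * (lincomb b t w - h / v * lincomb a u w)))%:E =
   (expR (c * e + c ^+ 2 * (fine 'V_P[lincomb b t] - h ^+ 2 / v) / 2))%:E)%E.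
Proof.
move=> v h; have [a' [u' au']] := lincomb_add b t a u (- (h / v)).
(* The residual is again a combination of coordinates, hence Gaussian. Its mean stays anonymous: it
   cancels in the difference of two copies. *)
exists (\sum_(i < k + l) a' i * mu (u' i)) => c.
have lE w : lincomb a' u' w = lincomb b t w - h / v * lincomb a u w.
  by rewrite /lincomb (au' (fun t => W t w)) mulNr.
transitivity (\int[P]_w (expR (c * lincomb a' u' w))%:E)%E.
  by apply: eq_integral => w _; rewrite lE.
rewrite lincomb_mgf.
suff -> : fine 'V_P[lincomb a' u'] = fine 'V_P[lincomb b t] - h ^+ 2 / v by [].
have L2 k' (b' : 'I_k' -> R) t' : lincomb b' t' \in Lfun P 2%:E.
  by apply: lincomb_Lfun2 => i; exact: gaussian_process_Lfun2.
have Pfin : P [set: Omega] \is a fin_num := fin_num_measure P _ measurableT.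
rewrite (_ : lincomb a' u' = lincomb b t \+ (- (h / v)) \o* lincomb a u); last first.
  by apply/funext => w; rewrite lE /= mulrN mulrC.
rewrite varianceD//; last by apply: Lfun_scale; rewrite ?ler1n.
have L1 k' (b' : 'I_k' -> R) t' := Lfun_subset12 Pfin (L2 k' b' t').
rewrite varianceZ// (covarianceZr _ (L1 _ b t) (L1 _ a u) (Lfun2_mul_Lfun1 (L2 _ b t) (L2 _ a u))).
rewrite lincomb_kernel_covariance -/h.
rewrite -(fineK (variance_fin_num (L2 _ a u))) -(fineK (variance_fin_num (L2 _ b t))).
rewrite -!EFinM -!EFinD /= -/v.
have [->|v0] := eqVneq v 0; first by rewrite invr0 !mulr0; ring.
by field.
Qed.

(** By Cauchy-Schwarz the covariance with a variable of variance zero is at most zero; the multiples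
    1 and -1 of [W t] give both signs. *)
Lemma variance0_kernel_comb l (a : 'I_l -> R) (u : 'I_l -> I) t :
  fine 'V_P[lincomb a u] = 0 -> \sum_(j < l) a j * sigma t (u j) = 0.
Proof.
move=> v0.
have L2 : lincomb a u \in Lfun P 2%:E.
  by apply: lincomb_Lfun2 => i; exact: gaussian_process_Lfun2.
have V0 : 'V_P[lincomb a u]%E = 0%E by rewrite -(fineK (variance_fin_num L2)) v0.
have le0 c : c * (\sum_(j < l) a j * sigma t (u j)) <= 0.
  have := lincomb_kernel_covariance (fun _ : 'I_1 => c) (fun=> t) a u.
  rewrite big_ord1 -lee_fin => <-.
  apply: le_trans (covariance_le _ L2) _.
    by apply: lincomb_Lfun2 => i; exact: gaussian_process_Lfun2.
  by rewrite V0 sqrte0 mule0.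
by apply/le_anti/andP; split; [have := le0 1|have := le0 (-1)]; lra.
Qed.

End gaussian_lincomb.

(** * Product measures and intervals under the normal law *)

Lemma ge0_integral_prodM d1 d2 (T1 : measurableType d1) (T2 : measurableType d2)
    (R : realType) (m1 : {sigma_finite_measure set T1 -> \bar R})
    (m2 : {sigma_finite_measure set T2 -> \bar R}) (f : T1 -> R) (g : T2 -> R) :
  (forall x, 0 <= f x) -> (forall y, 0 <= g y) ->
  measurable_fun [set: T1] f -> measurable_fun [set: T2] g ->
  (\int[m1 \x m2]_z (f z.1 * g z.2)%:E =
   (\int[m1]_x (f x)%:E) * (\int[m2]_y (g y)%:E))%E.
Proof.
move=> f0 g0 mf mg.
rewrite (fubini_tonelli1 (fun z : T1 * T2 => (f z.1 * g z.2)%:E)); last 2 first.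
- apply/measurable_EFinP; apply: measurable_funM.
    exact: measurableT_comp.
  exact: measurableT_comp.
- by move=> z; rewrite lee_fin mulr_ge0.
rewrite /fubini_F /=.
under eq_integral => x _.
  under eq_integral do rewrite EFinM.
  rewrite ge0_integralZl//; last 3 first.
  - exact/measurable_EFinP.
  - by move=> y _; rewrite lee_fin.
  - by rewrite lee_fin.
  over.
rewrite ge0_integralZr//; first exact/measurable_EFinP.
- by move=> x _; rewrite lee_fin.
- by apply: integral_ge0 => y _; rewrite lee_fin.
Qed.

Section product3.
Local Open Scope ereal_scope.
Context d1 d2 d3 (T1 : measurableType d1) (T2 : measurableType d2)
  (T3 : measurableType d3) (R : realType).
Variables (m1 : probability T1 R) (m2 : probability T2 R) (m3 : probability T3 R).

Let m12 : subprobability (T1 * T2)%type R :=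
  product_subprobability ((m1 : subprobability T1 R), (m2 : subprobability T2 R)).

Definition product_measure3 : {measure set ((T1 * T2) * T3) -> \bar R} :=
  m12 \x m3.

Lemma product_measure3E A1 A2 A3 : measurable A1 -> measurable A2 -> measurable A3 ->
  product_measure3 ((A1 `*` A2) `*` A3) = m1 A1 * m2 A2 * m3 A3.
Proof.
move=> mA1 mA2 mA3; rewrite /product_measure3/= product_measure1E//; last exact: measurableX.
by rewrite [X in X * _]product_measure1E.
Qed.

Lemma ge0_integral_product_measure3 (f : T1 -> R) (g : T2 -> R) (h : T3 -> R) :
  (forall x, 0 <= f x)%R -> (forall y, 0 <= g y)%R -> (forall y, 0 <= h y)%R ->
  measurable_fun [set: T1] f -> measurable_fun [set: T2] g ->
  measurable_fun [set: T3] h ->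
  \int[product_measure3]_z (f z.1.1 * g z.1.2 * h z.2)%:E =
   (\int[m1]_x (f x)%:E) * (\int[m2]_y (g y)%:E) * (\int[m3]_y (h y)%:E).
Proof.
move=> f0 g0 h0 mf mg mh.
pose fg (y : T1 * T2) := (f y.1 * g y.2)%R.
have fg0 y : (0 <= fg y)%R by exact: mulr_ge0.
have mfg : measurable_fun setT fg.
  by apply: measurable_funM; [exact: (measurableT_comp mf)|exact: (measurableT_comp mg)].
rewrite -(ge0_integral_prodM m1 m2 f0 g0 mf mg).
exact: (ge0_integral_prodM m12 m3 fg0 h0 mfg mh).
Qed.

End product3.

Lemma normal_prob_itv_gt0 (R : realType) (a b : R) : a < b ->
  (0 < normal_prob 0 1 `[a, b])%E.
Proof.
move=> ab; rewrite /normal_prob.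
(* [M] bounds the absolute values on [[a, b]], so the constant [c] bounds the density from below
   there. *)
pose M := Num.max `|a| `|b|; pose c : R := normal_peak 1 * expR (- M ^+ 2 / 2).
have c0 : 0 < c by rewrite mulr_gt0 ?expR_gt0// normal_peak_gt0 ?oner_neq0.
apply: (@lt_le_trans _ _ (\int[lebesgue_measure]_(x in `[a, b]) c%:E)%E).
  rewrite integral_cst//= lebesgue_measure_itv/= lte_fin ab.
  by rewrite -EFinB -EFinM lte_fin mulr_gt0// subr_gt0.
apply: ge0_le_integral => //=.
- by move=> x _; rewrite lee_fin ltW.
- by apply: measurable_funTS; apply: measurableT_comp => //; exact: measurable_normal_pdf.
- move=> x; rewrite in_itv/= => /andP[ax xb].
  rewrite lee_fin normal_pdfE ?oner_neq0// /c /normal_fun.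
  rewrite ler_pM2l ?normal_peak_gt0 ?oner_neq0// ler_expR subr0 expr1n.
  rewrite !mulNr lerN2 ler_pM2r ?invr_gt0// -(real_normK (num_real x)).
  rewrite lerXn2r ?nnegrE// ?le_max ?normr_ge0//.
  have [x0|x0] := leP 0 x.
    by rewrite (ger0_norm x0) (le_trans xb (ler_norm _)) orbT.
  have aN : - a <= `|a| by rewrite -normrN ler_norm.
  by rewrite (ltr0_norm x0) (le_trans _ aN)// lerN2.
Qed.

(** * The resampled process and its law *)

Section resampling.
Context (dO : measure_display) (Omega : measurableType dO) (R : realType).
Context (P : probability Omega R) (I : Type) (W : I -> {RV P >-> R}).
Variables (mu : I -> R) (sigma : I -> I -> R).
Hypotheses (gW : gaussian_process W) (mW : has_mean W mu)
  (cW : has_covariance W sigma).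
Variables (l : nat) (a : 'I_l -> R) (u : 'I_l -> I).

Let Y (x : Omega) := \sum_(i < l) a i * W (u i) x.
Let v := fine 'V_P[Y].
Let h t := \sum_(j < l) a j * sigma t (u j).

Definition residual t x := W t x - h t / v * Y x.

(* This process has the law of [W]. *)
Definition resample (z : (Omega * Omega) * measurableTypeR R) : I -> R :=
  fun t => (residual t z.1.1 - residual t z.1.2) / Num.sqrt 2 +
    h t / Num.sqrt v * z.2 + mu t.

Let Q := product_measure3 P P (normal_prob 0 1).

Lemma measurable_residual t : measurable_fun [set: Omega] (residual t).
Proof.
apply: measurable_funB => //; apply: measurable_funM => //.
exact: measurable_lincomb.
Qed.

Let residual_comb k (b : 'I_k -> R) (t : 'I_k -> I) x :
  \sum_(i < k) b i * residual (t i) x =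
  \sum_(i < k) b i * W (t i) x - (\sum_(i < k) b i * h (t i)) / v * Y x.
Proof.
rewrite !mulr_suml -sumrB; apply: eq_bigr => i _.
by rewrite /residual mulrBr !mulrA.
Qed.

Let resample_comb k (b : 'I_k -> R) (t : 'I_k -> I) z :
  \sum_(i < k) b i * resample z (t i) =
  (Num.sqrt 2)^-1 * (\sum_(i < k) b i * residual (t i) z.1.1) +
  - (Num.sqrt 2)^-1 * (\sum_(i < k) b i * residual (t i) z.1.2) +
  ((\sum_(i < k) b i * h (t i)) / Num.sqrt v * z.2 + \sum_(i < k) b i * mu (t i)).
Proof.
rewrite !mulr_sumr !mulr_suml -!big_split/=; apply: eq_bigr => i _.
by rewrite /resample; ring.
Qed.

(** Independence factors the integral. The residuals enter with opposite signs, so their means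
    cancel and their halved variances add up to the residual variance; the normal factor restores
    the missing [hL ^+ 2 / v]. *)
Lemma resample_mgf k (b : 'I_k -> R) (t : 'I_k -> I) :
  (\int[Q]_z (expR (\sum_(i < k) b i * resample z (t i)))%:E =
   \int[P]_x (expR (\sum_(i < k) b i * W (t i) x))%:E)%E.
Proof.
pose c : R := (Num.sqrt 2)^-1.
pose L x := \sum_(i < k) b i * residual (t i) x.
pose hL := \sum_(i < k) b i * h (t i).
pose muL := \sum_(i < k) b i * mu (t i).
have mL : measurable_fun [set: Omega] L.
  by apply: measurable_sum => i; apply: measurable_funM => //; exact: measurable_residual.
have mexp (e : R) : measurable_fun [set: Omega] (fun x => expR (e * L x)).
  by apply: measurableT_comp => //; exact: measurable_funM.
pose f1 x := expR (c * L x); pose f2 x := expR (- c * L x).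
pose g (y : measurableTypeR R) := expR muL * expR (hL / Num.sqrt v * y).
transitivity (\int[Q]_z (f1 z.1.1 * f2 z.1.2 * g z.2)%:E)%E.
  apply: eq_integral => z _; rewrite resample_comb /f1 /f2 /g -!expRD.
  by congr (expR _)%:E; rewrite [in RHS](addrC muL).
have f1_ge0 x : 0 <= f1 x by exact: expR_ge0.
have f2_ge0 x : 0 <= f2 x by exact: expR_ge0.
have g_ge0 x : 0 <= g x by rewrite mulr_ge0 ?expR_ge0.
have mg : measurable_fun setT g.
  by apply: measurable_funM => //; apply: measurableT_comp => //; exact: measurable_funM.
rewrite (ge0_integral_product_measure3 _ _ _ f1_ge0 f2_ge0 g_ge0 (mexp c) (mexp (- c)) mg).
rewrite /f1 /f2 /g.
have [e mgfL] := residual_mgf gW mW cW b t a u.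
have mgfL' q : (\int[P]_x (expR (q * L x))%:E = (expR (q * e + q ^+ 2 *
    (fine 'V_P[fun x => \sum_(i < k) b i * W (t i) x] - hL ^+ 2 / v) / 2))%:E)%E.
  rewrite -mgfL; apply: eq_integral => x _.
  by rewrite /L residual_comb.
rewrite (mgfL' c) (mgfL' (- c)).
under [X in (_ * X)%E]eq_integral do rewrite EFinM.
rewrite ge0_integralZl ?lee_fin ?expR_ge0//; last first.
  by apply/measurable_EFinP; apply: measurableT_comp => //; exact: measurable_funM.
rewrite normal_prob_mgf ?oner_neq0//.
have := lincomb_mgf gW mW b t 1; rewrite -/muL.
under eq_integral do rewrite mul1r.
move=> ->; rewrite -!EFinM -!expRD; congr (expR _)%:E.
have c2 : c ^+ 2 = 2^-1 by rewrite exprVn sqr_sqrtr.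
have v0 : 0 <= v by rewrite fine_ge0// variance_ge0.
have hv : (hL / Num.sqrt v) ^+ 2 = hL ^+ 2 / v by rewrite exprMn exprVn sqr_sqrtr.
by rewrite hv sqrrN c2; move: (hL ^+ 2 / v) => q; lra.
Qed.

Lemma measurable_resample t : measurable_fun setT (fun z => resample z t).
Proof.
apply: measurable_funD => //; apply: measurable_funD.
  apply: measurable_funM => //; apply: measurable_funB.
    by apply: (measurableT_comp (measurable_residual t)); exact: measurableT_comp.
  by apply: (measurableT_comp (measurable_residual t)); exact: measurableT_comp.
exact: measurable_funM.
Qed.

Lemma measurable_close (D : nat -> I) (w : I -> R) (r : R) :
  measurable [set x | forall n, `|W (D n) x - w (D n)| <= r].
Proof.
rewrite (_ : [set x | _] = \bigcap_n ([set: Omega] `&`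
    (fun x => `|W (D n) x - w (D n)|) @^-1` `]-oo, r])).
  apply: bigcapT_measurable => n.
  have : measurable_fun [set: Omega] (fun x => `|W (D n) x - w (D n)|).
    by apply: measurableT_comp => //; exact: measurable_funB.
  by apply => //; exact: measurable_itv.
apply/seteqP; split=> x /= h' n; first by move=> _; split=> //=; rewrite in_itv/=.
by have [_ /=] := h' n Logic.I; rewrite in_itv.
Qed.

(** The base functionals have equal expectations by [resample_mgf], and the indicator of [B] lies in
    their closure. *)
Lemma resample_close (D : nat -> I) (w : I -> R) (r : R) :
  let B := [set s : I -> R | forall n, `|s (D n) - w (D n)| <= r] in
  Q.-integrable setT (fun z => (\1_B (resample z))%:E) /\
  P [set x | forall n, `|W (D n) x - w (D n)| <= r] =
    (\int[Q]_z (\1_B (resample z))%:E)%E.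
Proof.
move=> B.
have [] := @dclosure_integral _ _ _ _ _ _ P Q (fun x t => W t x) resample
  exp_comb _ _ (exp_dclosure_close D w r).
  move=> _ [k [b [t ->]]].
  have mWt : measurable_fun [set: Omega] (fun x => expR (\sum_(i < k) b i * W (t i) x)).
    by apply: measurableT_comp => //; exact: measurable_lincomb.
  have mX : measurable_fun setT (fun z => expR (\sum_(i < k) b i * resample z (t i))).
    apply: measurableT_comp => //; apply: measurable_sum => i.
    by apply: measurable_funM => //; exact: measurable_resample.
  have fin : (\int[P]_x (expR (\sum_(i < k) b i * W (t i) x))%:E < +oo)%E.
    have := lincomb_mgf gW mW b t 1; under eq_integral do rewrite mul1r.
    by move=> ->; rewrite ltry.
  split; last by rewrite resample_mgf.
  - apply/integrableP; split; first exact/measurable_EFinP.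
    by under eq_integral do rewrite /= ger0_norm ?expR_ge0//.
  - apply/integrableP; split; first exact/measurable_EFinP.
    under eq_integral do rewrite /= ger0_norm ?expR_ge0//.
    by rewrite resample_mgf.
move=> _ iB <-; split => //.
rewrite -[X in P X]setIT -integral_indic//; last exact: measurable_close.
Qed.


(** On the rectangle [E * E * J] the resampled path is within [eta + M * delta + e] of [w] along
    [D], and the rectangle has mass [P(E)^2 N(J) > 0], with [N] the standard normal law. *)
Lemma close_to_kernel_comb_gt0 (D : nat -> I) (w : I -> R) (E : set Omega)
    (M e eta delta r : R) :
  measurable E -> (0 < P E)%E -> 0 < delta ->
  (forall x x' n, E x -> E x' -> `|residual (D n) x - residual (D n) x'| <= eta) ->
  (forall t, `|h t| <= M) ->
  (forall t, `|w t - mu t - h t| <= e) ->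
  eta + M * delta + e <= r ->
  (0 < P [set x | forall n, (`|W (D n) x - w (D n)| <= r)%R])%E.
Proof.
move=> mE PE delta0 Eeta hM we er.
have [J [mJ NJ hJ]] : exists J : set (measurableTypeR R), [/\ measurable J,
    (0 < normal_prob 0 1 J)%E & forall t y, J y -> `|h t / Num.sqrt v * y - h t| <= M * delta].
  (* If [v = 0] then [h] vanishes and any interval serves. Otherwise [J] is centred at [Num.sqrt v]
     with relative radius [delta]. *)
  have [v0|v0] := eqVneq v 0.
    exists `[0, 1]%classic; split => //; first by apply: normal_prob_itv_gt0.
    move=> t y _; rewrite v0 sqrtr0 invr0 mulr0 mul0r sub0r normrN.
    by rewrite /h (variance0_kernel_comb gW cW t v0) normr0 mulr_ge0 ?(le_trans _ (hM t))// ltW.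
  have sv0 : 0 < Num.sqrt v.
    by rewrite sqrtr_gt0 lt_neqAle eq_sym v0 fine_ge0// variance_ge0.
  exists `[Num.sqrt v - delta * Num.sqrt v, Num.sqrt v + delta * Num.sqrt v]%classic.
  split => //; first by apply: normal_prob_itv_gt0; have := mulr_gt0 delta0 sv0; lra.
  move=> t y /=; rewrite in_itv/= => /andP[y1 y2].
  rewrite (_ : _ - h t = h t * ((y - Num.sqrt v) / Num.sqrt v)); last first.
    by field; rewrite gt_eqF.
  rewrite normrM; apply: ler_pM => //.
  rewrite normrM normfV (gtr0_norm sv0) ler_pdivrMr// ler_norml.
  by apply/andP; split; lra.
have [iB ->] := resample_close D w r.
apply: (@lt_le_trans _ _ (Q ((E `*` E) `*` J))).
  by rewrite (product_measure3E P P (normal_prob 0 1) mE mE mJ) !mule_gt0.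
rewrite -[X in Q X]setIT -integral_indic//; last by apply: measurableX => //; exact: measurableX.
apply: ge0_le_integral => //.
- apply/measurable_EFinP; apply: measurable_indic.
  by apply: measurableX => //; exact: measurableX.
- exact: measurable_int iB.
move=> z _; rewrite lee_fin !indicE ler_nat.
case: (boolP (z \in _)) => // /set_mem[[Ez1 Ez2] Jz].
rewrite mem_set// => n.
(* Division by [Num.sqrt 2] does not enlarge the residual difference. *)
have s2 : 1 <= Num.sqrt (2 : R).
  by rewrite -[leLHS]sqrtr1 ler_wsqrtr// ler1n.
have := Eeta _ _ n Ez1 Ez2; have := hJ (D n) _ Jz; have := we (D n).
rewrite /resample.
set x1 := residual _ _ - residual _ _; set x2 := h (D n) / _ * _.
move=> h1 h2 h3.
have h4 : `|x1 / Num.sqrt 2| <= eta.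
  rewrite normrM (le_trans _ h3)// ler_piMr// normfV ger0_norm ?sqrtr_ge0//.
  by rewrite invf_le1// (lt_le_trans _ s2).
rewrite (_ : _ - w (D n) = x1 / Num.sqrt 2 + (x2 - h (D n)) -
    (w (D n) - mu (D n) - h (D n))); last by ring.
rewrite (le_trans (ler_normB _ _))// (le_trans _ er)// lerD//.
by rewrite (le_trans (ler_normD _ _))// lerD.
Qed.

End resampling.

(** * Kernel combinations and the theorem *)

Section rkhs.
Context {R : realType} {I : topologicalType}.
Variable sigma : I -> I -> R.

Lemma rkhs_approx (f : I -> R) (e : R) : rkhs sigma f -> 0 < e ->
  exists2 g, kernel_span sigma g & forall t, `|f t - g t| < e.
Proof.
move=> /rkhsP fP /fP[g sg fg]; exists g => // t; rewrite -lte_fin.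
by apply: le_lt_trans fg; apply: ereal_sup_ubound; exists t.
Qed.

Lemma rkhs_subr_approx (f g : I -> R) (e : R) :
  rkhs sigma f -> rkhs sigma g -> 0 < e ->
  exists k (a : 'I_k -> R) (u : 'I_k -> I),
    forall t, `|f t - g t - \sum_(i < k) a i * sigma t (u i)| <= e.
Proof.
move=> hf hg e0; have e2 : 0 < e / 2 by rewrite divr_gt0.
have [_ [k [a [u [_ ->]]]] fE] := rkhs_approx hf e2.
have [_ [l [b [s [_ ->]]]] gE] := rkhs_approx hg e2.
have [c [r cr]] := lincomb_add a u b s (- 1).
exists (k + l)%N, c, r => t; rewrite (cr (sigma t)) mulN1r.
have := fE t; have := gE t; rewrite !ltr_norml ler_norml => /andP[? ?] /andP[? ?].
by apply/andP; split; lra.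
Qed.

Hypothesis sigma_continuous : continuous (fun st : (I * I)%type => sigma st.1 st.2).

Lemma kernel_comb_continuous k (a : 'I_k -> R) (u : 'I_k -> I) :
  continuous (fun t => \sum_(i < k) a i * sigma t (u i)).
Proof.
move=> t; apply: cvg_big => [|i _]; first exact: add_continuous.
apply: cvgM; first exact: cvg_cst.
have := @sigma_continuous (t, u i).
apply: (cvg_comp (fun x => (x, u i)) (fun st => sigma st.1 st.2)).
by apply: cvg_pair; [exact: cvg_id|exact: cvg_cst].
Qed.

Lemma rkhs_continuous (f : I -> R) : rkhs sigma f -> continuous f.
Proof.
move=> hf t; apply/cvgrPdist_lt => e e0.
have e3 : 0 < e / 3 by rewrite divr_gt0.
have [_ [k [a [u [_ ->]]]] fE] := rkhs_approx hf e3.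
have := @kernel_comb_continuous k a u t.
move=> /cvgrPdist_lt /(_ _ e3); apply: filterS => s /=.
have := fE t; have := fE s.
rewrite !ltr_norml => /andP[? ?] /andP[? ?] /andP[? ?].
by apply/andP; split; lra.
Qed.

End rkhs.

Lemma compact_continuous_bounded (R : realType) (X : topologicalType) (f : X -> R) :
  compact [set: X] -> continuous f -> exists2 M : R, 0 < M & forall x, `|f x| <= M.
Proof.
move=> cX cf.
have : compact (range f).
  by apply: continuous_compact => //; exact: continuous_subspaceT.
move=> /compact_bounded[N [_ /(_ (`|N| + 1))]].
rewrite (le_lt_trans (ler_norm N)) ?ltrDl// => /(_ isT) h.
exists (`|N| + 1) => [|x]; first by rewrite ltr_wpDl.
by apply: h; exists x.
Qed.

Lemma gaussian_process_close_gt0 (R : realType) (I : topologicalType)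
    (dO : measure_display) (Omega : measurableType dO)
    (P : probability Omega R) (W : I -> {RV P >-> R})
    (mu : I -> R) (sigma : I -> I -> R) (w : I -> R) (eps : R) :
  @second_countable I -> compact [set: I] ->
  gaussian_process W -> (forall omega, continuous (fun t => W t omega)) ->
  has_mean W mu -> has_covariance W sigma ->
  continuous (fun st : (I * I)%type => sigma st.1 st.2) ->
  rkhs sigma mu -> rkhs sigma w -> 0 < eps ->
  (0 < P [set omega | ereal_sup (range (fun t => `|W t omega - w t|%:E))
                      < eps%:E])%E.
Proof.
move=> scI cI W_gaussian W_continuous W_mean W_covariance sigma_continuous.
move=> mu_rkhs w_rkhs eps0.
(* On an empty index set the supremum is [-oo] and the event is certain. *)
have [[t0 _]|I0] := pselect (exists t : I, True); last first.
  rewrite (_ : [set _ | _] = setT) ?probability_setT//.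
  apply/seteqP; split => // x _ /=; apply: (@le_lt_trans _ _ -oo%E); last exact: ltNyr.
  by apply: ge_ereal_sup => y [t _ _]; exfalso; apply: I0; exists t.
have [U [D [U_basis D_dense]]] := second_countable_dense_seq t0 scI.
(* Error budget: [eps / 8] for approximating [w - mu], [2 * (eps / 16)] for the residuals and
   [M * (eps / 8 / M)] for the normal factor, below [eps / 2] in total. *)
have e8 : 0 < eps / 8 by rewrite divr_gt0.
have [k [a [u wE]]] := rkhs_subr_approx w_rkhs mu_rkhs e8.
have ch : continuous (fun t => \sum_(i < k) a i * sigma t (u i)).
  exact: kernel_comb_continuous.
have [M M0 hM] := compact_continuous_bounded cI ch.
have w_continuous : continuous w by exact: rkhs_continuous w_rkhs.
have residual_continuous x : continuous (fun t => residual W sigma a u t x).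
  move=> t; apply: cvgB; first exact: W_continuous.
  by apply: cvgM; [apply: cvgM; [exact: ch|exact: cvg_cst]|exact: cvg_cst].
have e16 : 0 < eps / 16 by rewrite divr_gt0.
have [E [mE PE EE]] := close_paths_event D U_basis P e16 cI
  (measurable_residual W sigma a u) residual_continuous.
pose G (r : R) := [set x | forall n, `|W (D n) x - w (D n)| <= r].
have G0 : (0 < P (G (eps / 2)%R))%E.
  apply: (close_to_kernel_comb_gt0 W_gaussian W_mean W_covariance mE PE
    (divr_gt0 e8 M0) EE hM wE).
  rewrite [M * _]mulrC divfK ?gt_eqF//; lra.
have closeP (r : R) x : G r x -> forall t, `|W t x - w t| <= r.
  move=> Gx; apply: (dense_seq_le U_basis D_dense _ Gx) => t.
  by apply: cvg_norm; apply: cvgB; [exact: W_continuous|exact: w_continuous].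
set A := [set x | _].
(* Needed for measurability: the supremum over [I] becomes countably many conditions along [D], and
   the strict bound a countable union of weak ones. *)
have AE : A = \bigcup_n G (eps - n.+1%:R^-1).
  apply/seteqP; split => [x /= supx|x [n _ /closeP Gx] /=]; last first.
    apply: (@le_lt_trans _ _ (eps - n.+1%:R^-1)%:E).
      by apply: ge_ereal_sup => _ [t _ <-]; rewrite lee_fin.
    by rewrite lte_fin ltrBlDr ltrDl invr_gt0.
  have [r reps rx] : exists2 r, r < eps & forall t, `|W t x - w t| <= r.
    have sup_ge t : (`|W t x - w t|%:E <=
        ereal_sup (range (fun t => `|W t x - w t|%:E)))%E.
      by apply: ereal_sup_ubound; exists t.
    (* The supremum is a real number: it lies below [eps], and its value at [t0] excludes [-oo]. *)
    move: supx sup_ge; rewrite /A/=; case: ereal_sup => [r| |] //.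
      by rewrite lte_fin => rlt sup_ge; exists r => // t; rewrite -lee_fin.
    by move=> _ /(_ t0).
  have [n] : exists n, n.+1%:R^-1 < eps - r.
    have [n] := @ltr_add_invr R 0 (eps - r) ltac:(by rewrite subr_gt0).
    by rewrite add0r; exists n.
  move=> rn; exists n => // m; rewrite (le_trans (rx _))//.
  by rewrite lerBrDr -lerBrDl ltW.
have mA : measurable A.
  by rewrite AE; apply: bigcupT_measurable => n; exact: measurable_close.
apply: (lt_le_trans G0); apply: le_measure; rewrite ?inE//.
  exact: measurable_close.
move=> x /closeP Gx /=; apply: (@le_lt_trans _ _ (eps / 2)%:E).
  by apply: ge_ereal_sup => _ [t _ <-]; rewrite lee_fin.
by rewrite lte_fin; lra.
Qed.

Theorem theorem4 (R : realType) (d : nat) (T : set 'rV[R]_d)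
    (dO : measure_display) (Omega : measurableType dO)
    (P : probability Omega R) (W : T -> {RV P >-> R})
    (mu : T -> R) (sigma : T -> T -> R) (w : T -> R)
    (T_compact : compact T)
    (W_gaussian : gaussian_process W)
    (W_continuous : forall omega : Omega, continuous (fun t : T => W t omega))
    (W_mean : has_mean W mu)
    (W_covariance : has_covariance W sigma)
    (sigma_continuous :
       continuous (fun st : (T * T)%type => sigma st.1 st.2))
    (mu_rkhs : rkhs sigma mu)
    (w_rkhs : rkhs sigma w) :
  forall eps : R, 0 < eps ->
    (0 < P [set omega | ereal_sup (range (fun t : T => `|W t omega - w t|%:E))
                        < eps%:E])%E.
Proof.
move=> eps eps0.
exact: (gaussian_process_close_gt0 (compact_second_countable_set_type T_compact)
  (compact_set_type T_compact) W_gaussian).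
Qed.
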